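(* Let $(\mathcal{A}_{LT,\eta})_{\eta\in(0,1)}$ be a family of oracle algorithms with the guarantees (LT1)–(LT3) stated in the context. Suppose that $\mathcal{M}: D^n\to R\times\mathbb{R}$ is $\varepsilon$-DP, let $\gamma\in(0,1)$, $K>1$, and let $c>1$ be an integer. Let $\mathcal{A}$ be the algorithm that, on input $d$, runs $\mathcal{A}_{LT,\gamma^{1/c}/K}^{\mathcal{M}}(d)$ independently $c$ times and outputs, among the $c$ resulting tuples, one with the highest quality score. Then: (Privacy) $\mathcal{A}: D^n\to R\times\mathbb{R}$ is $3c\varepsilon$-DP. (Runtime) $\mathcal{A}$ on input $d$ makes in expectation $O\!\left(\frac{Kc}{\gamma^{1/c}}\right)$ calls to $\mathcal{M}$. (Utility) For every input $d$, $\Pr[\mathrm{val}(\mathcal{A}(d))\ge q_{1-\frac1K}(\mathcal{M}(d))]\ge 1-\gamma$, where the quantile $q_{1-\frac1K}=q_{1-\frac1K}(\mathcal{M}(d))$ is a real number such that $\Pr[\mathrm{val}(\mathcal{M}(d))\ge q_{1-\frac1K}]\ge\frac1K$.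
   Context: For a set $D$ and integer $n\ge1$, a dataset is an element of $D^n$; $d,d'$ are neighboring if they differ in exactly one entry. A randomized algorithm (mechanism) $\mathcal{M}$ on $D^n$ is $\varepsilon$-differentially private ($\varepsilon$-DP) if for all neighboring $d,d'$ and all (measurable) sets $S$ of outputs, $\Pr[\mathcal{M}(d)\in S]\le e^{\varepsilon}\Pr[\mathcal{M}(d')\in S]$. Mechanisms output a tuple $(o,v)\in R\times\mathbb{R}$, where $R$ is an arbitrary output space and $v$ is the quality score; $\mathrm{val}((o,v))=v$. An oracle algorithm run with oracle $\mathcal{M}$ may call $\mathcal{M}$ repeatedly, each call returning a fresh independent sample, and outputs one of the tuples it received. Probabilities and expectations are over the randomness of both the oracle algorithm and $\mathcal{M}$. Known guarantees (Liu–Talwar), to be taken as given: there is an absolute constant $C$ such that for every $\eta\in(0,1)$, every $\varepsilon>0$ and every $\varepsilon$-DP mechanism $\mathcal{M}:D^n\to R\times\mathbb{R}$: (LT1) $\mathcal{A}_{LT,\eta}^{\mathcal{M}}: D^n\to R\times\mathbb{R}$ is $3\varepsilon$-DP; (LT2) $\mathcal{A}_{LT,\eta}^{\mathcal{M}}$ on any input $d$ makes at most $C/\eta$ calls to $\mathcal{M}$ in expectation; (LT3) for every input $d$, every $K>1$, and every real $q$ with $\Pr[\mathrm{val}(\mathcal{M}(d))\ge q]\ge \frac1K$, $\Pr[\mathrm{val}(\mathcal{A}_{LT,\eta}^{\mathcal{M}}(d))\ge q]\ge 1-K\eta$. The constant in the $O(\cdot)$ of the claim is absolute (depends only on $C$).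 *)

(* Defs.v *)
From HB Require Import structures.
From mathcomp Require Import all_boot all_order all_algebra.
From mathcomp Require Import all_classical all_reals all_analysis.
From mathcomp Require Import measurable_realfun giry.

Set Implicit Arguments.
Unset Strict Implicit.
Unset Printing Implicit Defensive.
Import Order.TTheory GRing.Theory Num.Theory.
Import numFieldNormedType.Exports.

Local Open Scope classical_set_scope.
Local Open Scope ring_scope.

(* Laws live in the Giry monad: [giry T R] is the type of subprobabilities on T.
   For an algorithm that halts almost surely they are probabilities. *)
Section giry_complements.
Context {d} {T : measurableType d} {R : realType}.
Local Open Scope ereal_scope.

Section restriction.
Variables (mu : giry T R) (D : set T) (mD : measurable D).

Let restr_le1 : mrestr mu mD [set: T] <= 1.
Proof.
rewrite /mrestr setTI; apply: le_trans (@sprobability_setT _ _ _ mu).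
by apply: le_measure; rewrite ?inE.
Qed.

HB.instance Definition _ :=
  Measure_isSubProbability.Build _ _ _ (mrestr mu mD) restr_le1.

Definition giry_restr : giry T R := mrestr mu mD.

End restriction.

Section countable_sum.
Variables (mu : (giry T R)^nat).
Hypothesis mu_le1 : forall n, \sum_(0 <= k < n) mu k [set: T] <= 1.

Let sum_le1 : mseries mu 0 [set: T] <= 1.
Proof. by apply: lime_le; [exact: is_cvg_nneseries|exact: nearW]. Qed.

HB.instance Definition _ :=
  Measure_isSubProbability.Build _ _ _ (mseries mu 0) sum_le1.

Definition giry_sum : giry T R := mseries mu 0.

End countable_sum.

Lemma measurable_tuple_cons k : measurable_fun [set: T * k.-tuple T]
  (fun z => [the k.+1.-tuple T of z.1 :: z.2]).
Proof. exact: measurable_cons. Qed.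

(* The law of n independent draws from mu. *)
Fixpoint giry_iid (mu : giry T R) (n : nat) : giry (n.-tuple T) R :=
  match n with
  | 0 => giry_ret [tuple]
  | k.+1 => giry_map (@measurable_tuple_cons k) (giry_prod (mu, giry_iid mu k))
  end.

End giry_complements.

Section differential_privacy.
Context {R : realType} {D : Type} {n : nat} {d} {Y : measurableType d}.

Definition neighboring (x y : n.-tuple D) : Prop :=
  exists i : 'I_n, tnth x i <> tnth y i /\
    forall j : 'I_n, j != i -> tnth x j = tnth y j.

Definition diff_private (eps : R) (M : n.-tuple D -> giry Y R) : Prop :=
  forall x y, neighboring x y -> forall S : set Y, measurable S ->
    (M x S <= (expR eps)%:E * M y S)%E.

End differential_privacy.

(* A randomized algorithm on datasets in D^n with access to an oracle whose
   answers are tuples in O * R. It draws its coins once; then, as long as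
   [decide] returns None, it asks the oracle for one more answer; when [decide]
   returns [Some i] it halts and outputs the answer of index i. The decision
   after k calls depends on the input, on the coins, and on the k answers
   received so far, the most recent one being at index 0. *)
Record oracle_alg (D : Type) (n : nat) d (O : measurableType d) (R : realType)
    := OracleAlg {
  coins_display : measure_display ;
  coins : measurableType coins_display ;
  coin_law : probability coins R ;
  decide : n.-tuple D ->
    forall k : nat, (coins * k.-tuple (O * R))%type -> option 'I_k ;
  measurable_decide : forall x k (o : option 'I_k),
    measurable [set z | decide x z = o] }.

Definition score d (O : measurableType d) (R : realType) (v : O * R) : R := v.2.

Section execution.
Context {D : Type} {n : nat} {d} {O : measurableType d} {R : realType}.
Variables (A : oracle_alg D n O R) (x : n.-tuple D) (mu : giry (O * R)%type R).

Local Notation state k := (coins A * k.-tuple (O * R))%type.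

Let continuing k : set (state k) := [set z | decide x z = None].

Let halting k : set (state k) := ~` @continuing k.

Let measurable_continuing k : measurable (@continuing k).
Proof. exact: measurable_decide. Qed.

Let measurable_halting k : measurable (@halting k).
Proof. by apply: measurableC; exact: measurable_continuing. Qed.

Let start (w : coins A) : state 0 := (w, [tuple]).

Let measurable_start : measurable_fun [set: coins A] start.
Proof. exact: measurable_fun_pair. Qed.

Let receive k (z : state k * (O * R)) : state k.+1 :=
  (z.1.1, [the k.+1.-tuple (O * R)%type of z.2 :: z.1.2]).

Let measurable_receive k : measurable_fun [set: state k * (O * R)] (@receive k).
Proof.
apply: measurable_fun_pair; first exact: measurableT_comp.
by apply: measurable_cons => //; exact: measurableT_comp.
Qed.

(* The law of the coins and of the answers after k calls, restricted to the
   event that at least k calls are made. *)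
Fixpoint state_law (k : nat) : giry (state k) R :=
  match k with
  | 0 => giry_map measurable_start (coin_law A)
  | k.+1 => giry_map (@measurable_receive k)
      (giry_prod (giry_restr (state_law k) (@measurable_continuing k), mu))
  end.

(* The default value [point] is never used on a halting state. *)
Definition result k (z : state k) : nat * (O * R) :=
  (k, if decide x z is Some i then tnth z.2 i else point).

Lemma measurable_result k : measurable_fun [set: state k] (@result k).
Proof.
apply: measurable_fun_pair => //= _ B mB; rewrite setTI.
rewrite (_ : _ @^-1` _ = \bigcup_(o in [set: option 'I_k])
  ([set z | decide x z = o] `&`
   (fun z : state k => if o is Some i then tnth z.2 i else point) @^-1` B)).
  apply: fin_bigcup_measurable => // o _.
  apply: measurableI; first exact: measurable_decide.
  rewrite -[X in measurable X]setTI; case: o => [i|]; last exact: measurable_cst.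
  apply: (measurableT_comp (@measurable_tnth _ _ _ i)) => //.
apply/seteqP; split=> z /=; first by exists (decide x z).
by case=> o _ [/= ->].
Qed.

Let halt_law k : giry (nat * (O * R))%type R :=
  giry_map (@measurable_result k)
    (giry_restr (state_law k) (@measurable_halting k)).

Let halt_law_le1 N : (\sum_(0 <= k < N) halt_law k setT <= 1)%E.
Proof.
suff : (\sum_(0 <= k < N) halt_law k setT + state_law N setT <= 1)%E.
  by apply: le_trans; rewrite leeDl.
elim: N => [|N IH]; first by rewrite big_geq// add0e; exact: sprobability_setT.
apply: le_trans IH; rewrite big_nat_recr//= -addeA leeD2l//.
rewrite [leRHS](_ : _ = (mrestr (state_law N) (@measurable_halting N) setT +
  mrestr (state_law N) (@measurable_continuing N) setT)%E); last first.
  rewrite /mrestr !setTI -measureU; first by rewrite setvU.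
  - exact: measurable_halting.
  - exact: measurable_continuing.
  - exact: setICl.
apply: leeD; first by [].
rewrite [leLHS](_ : _ = (giry_prod (giry_restr (state_law N)
  (@measurable_continuing N), mu) (setT `*` setT))%E); last by rewrite setXTT.
rewrite [leLHS]product_measure1E// -[leRHS]mule1.
by rewrite lee_wpmul2l//; exact: sprobability_setT.
Qed.

(* The joint law of the number of oracle calls and of the output tuple, when
   every call returns a fresh sample of mu. The missing mass is the probability
   that the algorithm never halts. *)
Definition run : giry (nat * (O * R))%type R := giry_sum halt_law_le1.

End execution.

Section run_observables.
Context {d} {O : measurableType d} {R : realType}.
Implicit Type rho : giry (nat * (O * R))%type R.

Definition output rho : giry (O * R)%type R := giry_map measurable_snd rho.

(* A run that never halts makes infinitely many calls; 0 * +oo = 0. *)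
Definition expected_calls rho : \bar R :=
  (\int[rho]_z (z.1%:R)%:E + (1 - rho setT) * +oo)%E.

End run_observables.

(* The guarantees (with constant C) of the family A, one algorithm for each
   value of its parameter eta. *)
Definition LT_guarantees (D : Type) (n : nat) d (O : measurableType d)
    (R : realType) (C : R) (A : R -> oracle_alg D n O R) : Prop :=
  forall eta : R, 0 < eta < 1 -> forall eps : R, 0 < eps ->
  forall M : n.-tuple D -> probability (O * R)%type R,
  diff_private eps (fun x => M x) ->
  [/\ diff_private (3 * eps) (fun x => output (run (A eta) x (M x))),
      forall x, (expected_calls (run (A eta) x (M x)) <= (C / eta)%:E)%E
    & forall x (K q : R), 1 < K ->
        ((K^-1)%:E <= M x [set v | (q <= score v)%R])%E ->
        ((1 - K * eta)%:E
          <= output (run (A eta) x (M x)) [set v | (q <= score v)%R])%E].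

(* A rule choosing, in every c-tuple of outputs, one with the highest score;
   ties may be broken in any measurable way. *)
Record best_rule d (O : measurableType d) (R : realType) (c : nat) := BestRule {
  best :> c.-tuple (O * R)%type -> (O * R)%type ;
  measurable_best : measurable_fun [set: c.-tuple (O * R)%type] best ;
  best_mem : forall t, exists i, best t = tnth t i ;
  best_max : forall t i, score (tnth t i) <= score (best t) }.

Section best_of.
Context {d} {O : measurableType d} {R : realType} {c : nat}.
Variable b : best_rule O R c.

Local Notation runs := (c.-tuple (nat * (O * R))%type).

Definition combine (t : runs) : nat * (O * R) :=
  ((\sum_(i < c) (tnth t i).1)%N, b [tuple (tnth t i).2 | i < c]).

Lemma measurable_combine : measurable_fun [set: runs] combine.
Proof.
have mtnth i : measurable_fun [set: runs] (fun t => tnth t i).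
  exact: measurable_tnth.
apply: measurable_fun_pair.
  elim: (index_enum _) => [|i s IH].
    by under eq_fun do rewrite big_nil; exact: measurable_cst.
  under eq_fun do rewrite big_cons.
  by apply: measurable_fun_addn => //; exact: measurableT_comp.
apply: measurableT_comp; first exact: measurable_best.
apply/measurable_fun_tnthP => i.
rewrite (_ : _ \o _ = fun t : runs => (tnth t i).2).
  exact: measurableT_comp.
by apply/funext => t /=; rewrite tnth_mktuple.
Qed.

(* c independent runs, each with fresh coins and fresh oracle answers: the calls
   add up and a best of the c outputs is returned. *)
Definition best_of (rho : giry (nat * (O * R))%type R) :
    giry (nat * (O * R))%type R :=
  giry_map measurable_combine (giry_iid rho c).

End best_of.

(* Main.v *)
(* The output of the best-of-c algorithm is a post-processing, by the selection
   rule, of the c-fold product of the output law of a single run. Privacy is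
   then composition over the factors of a product measure. The score of the
   selected tuple falls below q only if that of every run does, an event of
   probability at most (K * eta)^c = gamma for eta = gamma^(1/c) / K. The
   expected number of calls is additive over the runs; the bound on a single run
   being finite, each run halts almost surely, so the product has full mass. *)
Require Import Defs.
From HB Require Import structures.
From mathcomp Require Import all_boot all_order all_algebra.
From mathcomp Require Import all_classical all_reals all_analysis.
From mathcomp Require Import measurable_realfun giry.
Set Implicit Arguments.
Unset Strict Implicit.
Unset Printing Implicit Defensive.
Import Order.TTheory GRing.Theory Num.Theory.
Import numFieldNormedType.Exports.
Local Open Scope classical_set_scope.
Local Open Scope ring_scope.

Lemma lee_expe (R : realType) (x y : \bar R) n :
  (0 <= x)%E -> (x <= y)%E -> (x ^+ n <= y ^+ n)%E.
Proof.
move=> x0 xy; elim: n => [|n IH]; first exact: lexx.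
by rewrite !expeS; apply: lee_pmul => //; exact: expe_ge0.
Qed.

(** * Products of two subprobabilities *)

Section giry_product.
Context {d1 d2} {T1 : measurableType d1} {T2 : measurableType d2}
  {R : realType}.
Implicit Types (mu : giry T1 R) (nu : giry T2 R).
Local Open Scope ereal_scope.

Lemma giry_prod_xsection mu nu S :
  giry_prod (mu, nu) S = \int[mu]_x nu (xsection S x).
Proof. by []. Qed.

(** Tonelli for the indicator of [S]. Here [nu] is the integrating measure, so [mu] can be replaced
    under the integral sign. *)
Lemma giry_prod_ysection mu nu S : measurable S ->
  giry_prod (mu, nu) S = \int[nu]_y mu (ysection S y).
Proof.
move=> mS; rewrite -[in LHS](setIT S) -integral_indic//.
rewrite [LHS]giry_int_prod2; last 2 first.
- by apply/measurable_EFinP; exact: measurable_indic.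
- by move=> z; rewrite lee_fin.
apply: eq_integral => y _.
rewrite -[ysection S y]setIT -integral_indic//; last exact: measurable_ysection.
by apply: eq_integral => x _; rewrite !indicE mem_ysection.
Qed.

(* Replacing one factor at a time, each step only compares two integrands
   against the same measure. *)
Lemma giry_prod_le mu mu' nu nu' (a b : R) S :
  (0 <= a)%R -> (0 <= b)%R ->
  (forall A, measurable A -> mu A <= a%:E * mu' A) ->
  (forall B, measurable B -> nu B <= b%:E * nu' B) ->
  measurable S ->
  giry_prod (mu, nu) S <= (a * b)%:E * giry_prod (mu', nu') S.
Proof.
move=> a0 b0 mule nule mS.
have mxs (n : giry T2 R) : measurable_fun setT (fun x => n (xsection S x)).
  exact: measurable_fun_xsection.
have mys (m : giry T1 R) : measurable_fun setT (fun y => m (ysection S y)).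
  exact: measurable_fun_ysection.
apply: (@le_trans _ _ (b%:E * giry_prod (mu, nu') S)).
  rewrite !giry_prod_xsection -ge0_integralZl_EFin//.
  apply: ge0_le_integral => //; first exact: measurable_funeM.
  by move=> x _; apply: nule; exact: measurable_xsection.
rewrite [(a * b)%R]mulrC EFinM -muleA lee_wpmul2l ?lee_fin//.
rewrite !giry_prod_ysection// -ge0_integralZl_EFin//.
apply: ge0_le_integral => //; first exact: measurable_funeM.
by move=> y _; apply: mule; exact: measurable_ysection.
Qed.

End giry_product.

(** * Independent draws: domination, product events, sums *)

Section giry_iid_theory.
Context {d} {T : measurableType d} {R : realType}.
Implicit Type mu : giry T R.
Local Open Scope ereal_scope.

(** Composition of privacy: each draw costs one factor [a], by induction through [giry_prod_le]. *)
Lemma giry_iid_le mu (nu : giry T R) (a : R) n S : (0 <= a)%R ->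
  (forall A, measurable A -> mu A <= a%:E * nu A) -> measurable S ->
  giry_iid mu n S <= (a ^+ n)%:E * giry_iid nu n S.
Proof.
move=> a0 mule; elim: n S => [|n IH] S mS; first by rewrite expr0 mul1e.
rewrite exprS; apply: giry_prod_le => //; first exact: exprn_ge0.
by rewrite -[X in measurable X]setTI; exact: measurable_tuple_cons.
Qed.

Lemma measurable_forall_tnth n (B : set T) : measurable B ->
  measurable [set t : n.-tuple T | forall i, B (tnth t i)].
Proof.
move=> mB.
rewrite [X in measurable X](_ : _ =
  \bigcap_(i in [set: 'I_n]) (fun t => tnth t i) @^-1` B).
  apply: fin_bigcap_measurable => // i _.
  by rewrite -[X in measurable X]setTI; exact: measurable_tnth.
by apply/seteqP; split=> t /= tB i; [move=> _|]; exact: tB.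
Qed.

Lemma giry_iid_forall mu n (B : set T) : measurable B ->
  giry_iid mu n [set t | forall i, B (tnth t i)] = mu B ^+ n.
Proof.
move=> mB; elim: n => [|n IH].
  by rewrite /= /dirac indicE mem_set// => -[].
rewrite expeS -IH -product_measure1E//; last exact: measurable_forall_tnth.
(* The preimage of the event under consing is the rectangle of [B] and the same event for the
   tail. *)
congr (giry_prod (mu, giry_iid mu n) _).
apply/seteqP; split=> -[x t] /= => [xtB|[xB tB] i].
  split; first by have := xtB ord0; rewrite (tnth_nth x).
  move=> i; have := xtB (lift ord0 i).
  by rewrite !(tnth_nth x).
case: (unliftP ord0 i) => [j ->|->]; last by rewrite (tnth_nth x).
by have := tB j; rewrite !(tnth_nth x).
Qed.

Lemma giry_iid_setT mu n : giry_iid mu n setT = mu setT ^+ n.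
Proof.
rewrite -giry_iid_forall//; congr (giry_iid mu n _).
by apply/seteqP; split.
Qed.

Lemma giry_int_iidS mu n (h : n.+1.-tuple T -> \bar R) :
  measurable_fun setT h -> (forall t, 0 <= h t) ->
  giry_int (giry_iid mu n.+1) h = giry_int mu (fun x =>
    giry_int (giry_iid mu n) (fun t => h [the n.+1.-tuple T of x :: t])).
Proof.
move=> mh h0; apply: etrans (giry_int_map _ _ mh h0) _.
apply: giry_int_prod1 => [|z]; last exact: h0.
by apply: measurableT_comp => //; exact: measurable_tuple_cons.
Qed.

(** Linearity of expectation, by splitting off the first draw. Full mass makes constants integrate
    to themselves. *)
Lemma giry_int_iid_sum mu n (f : T -> \bar R) : mu setT = 1 ->
  measurable_fun setT f -> (forall x, 0 <= f x) ->
  \int[giry_iid mu n]_t (\sum_(i < n) f (tnth t i)) = (\int[mu]_x f x) *+ n.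
Proof.
move=> mu1 mf f0.
have mS k : measurable_fun setT
    (fun t : k.-tuple T => \sum_(i < k) f (tnth t i)).
  apply: emeasurable_sum => i; apply: measurableT_comp => //.
  exact: measurable_tnth.
have S0 k (t : k.-tuple T) : 0 <= \sum_(i < k) f (tnth t i).
  by apply: sume_ge0.
elim: n => [|n IH].
  by under eq_integral do rewrite big_ord0; rewrite integral0.
have iid1 : giry_iid mu n setT = 1.
  by rewrite giry_iid_setT mu1; elim: (n) => // k ih; rewrite expeS ih mule1.
(* With the head [x] fixed, its term is constant in [t] and the tail is the induction hypothesis. *)
have sum_cons x : giry_int (giry_iid mu n)
    (fun t => \sum_(i < n.+1) f (tnth [the n.+1.-tuple T of x :: t] i))
    = f x + (\int[mu]_x f x) *+ n.
  transitivity (\int[giry_iid mu n]_t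
      (cst (f x) t + \sum_(i < n) f (tnth t i))).
    apply: eq_integral => t _; rewrite big_ord_recl /cst; congr (f _ + _).
    by apply: eq_bigr => i _; rewrite !(tnth_nth x).
  rewrite ge0_integralD//; last 2 first.
  - by move=> t _; exact: f0.
  - exact: mS.
  by rewrite IH integral_cst// [X in _ * X + _]iid1 mule1.
rewrite -[LHS]/(giry_int _ _) giry_int_iidS//.
transitivity (\int[mu]_x (f x + cst ((\int[mu]_x f x) *+ n) x)).
  by apply: eq_integral => x _; exact: sum_cons.
(* The constant is nonnegative because, by [IH], it is itself the integral of a nonnegative sum. *)
rewrite ge0_integralD//; last by move=> x _; rewrite -IH; exact: integral_ge0.
by rewrite integral_cst// [X in _ * X]mu1 mule1 [RHS]muleS.
Qed.

End giry_iid_theory.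

(** * Independent draws from an image law *)

Section giry_iid_map.
Context {d1 d2} {T1 : measurableType d1} {T2 : measurableType d2}
  {R : realType}.
Variables (f : T1 -> T2) (mf : measurable_fun [set: T1] f).

Lemma measurable_map_tuple n :
  measurable_fun [set: n.-tuple T1] (fun t => map_tuple f t).
Proof.
apply/measurable_fun_tnthP => i.
rewrite (_ : _ \o _ = f \o (fun t : n.-tuple T1 => tnth t i)).
  by apply: measurableT_comp => //; exact: measurable_tnth.
by apply/funext => t /=; rewrite tnth_map.
Qed.

Lemma giry_iid_map (mu : giry T1 R) n S : measurable S ->
  giry_iid (giry_map mf mu) n S
  = giry_iid mu n ((fun t => map_tuple f t) @^-1` S).
Proof.
elim: n S => [|n IH] S mS.
  rewrite /= /dirac !indicE; congr ((nat_of_bool _)%:R%:E).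
  by apply/idP/idP; rewrite !inE /= (tuple0 (map_tuple f [tuple])).
have mS' : measurable
    ((fun z : T2 * n.-tuple T2 => [the n.+1.-tuple T2 of z.1 :: z.2]) @^-1` S).
  by have := measurable_tuple_cons measurableT mS; rewrite setTI.
rewrite [LHS]giry_prod_xsection.
have mxs := measurable_fun_xsection (giry_iid (giry_map mf mu) n) mS'.
apply: etrans (giry_int_map mf mu mxs _) _; first by move=> x /=.
rewrite [RHS]giry_prod_xsection; apply: eq_integral => x _ /=.
rewrite IH; last exact: measurable_xsection.
congr (giry_iid mu n _); apply/funext => t.
(* Mapping before or after consing gives tuples with the same underlying list. *)
rewrite /xsection /= !inE /=; congr S; exact: val_inj.
Qed.

End giry_iid_map.

(** * Finite expected cost and almost sure halting *)

Section expected_calls_theory.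
Context {d} {O : measurableType d} {R : realType}.
Implicit Type rho : giry (nat * (O * R))%type R.
Local Open Scope ereal_scope.

(** Any missing mass is weighted by [+oo] in [expected_calls], so a finite value excludes it. *)
Lemma expected_calls_lty_mass rho : expected_calls rho < +oo -> rho setT = 1.
Proof.
move=> rhooo; apply/eqP; rewrite eq_le sprobability_setT leNgt/=.
apply/negP => rho1; move: rhooo; rewrite /expected_calls.
rewrite gt0_muley ?sube_gt0// addey ?ltxx// gt_eqF//.
by rewrite (@lt_le_trans _ _ 0)// integral_ge0// => z _; rewrite lee_fin.
Qed.

Lemma expected_calls_mass1 rho : rho setT = 1 ->
  expected_calls rho = \int[rho]_z (z.1%:R)%:E.
Proof. by move=> rho1; rewrite /expected_calls rho1 subee// mul0e adde0. Qed.

End expected_calls_theory.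

(** * Output law, cost and score of the best of [c] runs *)

Section best_of_theory.
Context {d} {O : measurableType d} {R : realType} {c : nat}.
Variable b : best_rule O R c.
Implicit Type rho : giry (nat * (O * R))%type R.

Lemma measurable_preimage_best (S : set (O * R)) :
  measurable S -> measurable (b @^-1` S).
Proof.
by move=> mS; have := measurable_best b measurableT mS; rewrite setTI.
Qed.

(** Selection ignores the call counts, so they can be projected away in each run before the runs are
    combined. *)
Lemma output_best_of rho S : measurable S ->
  output (best_of b rho) S = giry_iid (output rho) c (b @^-1` S).
Proof.
move=> mS; rewrite giry_iid_map; last exact: measurable_preimage_best.
congr (giry_iid rho c _); apply/funext => t /=; congr (S (b _)).
by apply: eq_from_tnth => i; rewrite tnth_mktuple tnth_map.
Qed.

Lemma output_setT rho : output rho setT = rho setT.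
Proof. by []. Qed.

Lemma best_of_setT rho : rho setT = 1%E -> best_of b rho setT = 1%E.
Proof.
move=> rho1; rewrite -[LHS]/(giry_iid rho c setT) giry_iid_setT rho1.
by elim: (c) => // k ih; rewrite expeS ih mule1.
Qed.

Lemma expected_calls_best_of rho : rho setT = 1%E ->
  expected_calls (best_of b rho) = (expected_calls rho *+ c)%E.
Proof.
move=> rho1; rewrite !expected_calls_mass1 ?best_of_setT//.
have mcalls : measurable_fun setT (fun z : nat * (O * R) => (z.1%:R : R)%:E).
  by apply/measurable_EFinP; apply: measurableT_comp => //.
rewrite -giry_int_iid_sum//.
apply: etrans (giry_int_map (measurable_combine b) _ mcalls _) _.
  by move=> z; rewrite lee_fin.
by apply: eq_integral => t _ /=; rewrite natr_sum sumEFin.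
Qed.

(** [best_max] gives one inclusion; the other holds because the selected tuple is one of the
    candidates, by [best_mem]. *)
Lemma best_preimage_score_lt (q : R) :
  b @^-1` [set v | score v < q] = [set t | forall i, score (tnth t i) < q].
Proof.
apply/seteqP; split=> t /=.
  by move=> bq i; exact: le_lt_trans (best_max b t i) bq.
by move=> tq; have [i ->] := best_mem b t; exact: tq.
Qed.

End best_of_theory.

Lemma giry_setC d (T : measurableType d) (R : realType) (mu : giry T R) A :
  mu setT = 1%E -> measurable A -> (mu (~` A) = 1 - mu A)%E.
Proof.
move=> mu1 mA; rewrite -mu1 -(setvU A) measureU ?addeK ?setICl//.
- by rewrite fin_num_measure.
- exact: measurableC.
Qed.

Theorem mainTheorem4 (R : realType) (C : R) :
  exists2 C' : R, 0 < C' &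
  forall (D : Type) (n : nat) (d : measure_display) (O : measurableType d)
    (LT : R -> oracle_alg D n O R),
  (0 < n)%N -> LT_guarantees C LT ->
  forall (eps : R) (M : n.-tuple D -> probability (O * R)%type R),
  0 < eps -> diff_private eps (fun x => M x) ->
  forall (gamma K : R) (c : nat) (b : best_rule O R c),
  0 < gamma < 1 -> 1 < K -> (1 < c)%N ->
  let A (x : n.-tuple D) :=
    best_of b (run (LT (gamma `^ (c%:R^-1) / K)) x (M x)) in
  [/\ diff_private (3 * c%:R * eps) (fun x => output (A x)),
      forall x, (expected_calls (A x)
                  <= (C' * (K * c%:R / gamma `^ (c%:R^-1)))%:E)%E
    & forall x (q : R),
        ((K^-1)%:E <= M x [set v | (q <= score v)%R])%E ->
        ((1 - gamma)%:E <= output (A x) [set v | (q <= score v)%R])%E].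
Proof.
(* The sign of [C] is unknown; the maximum with 1 gives a positive constant above [C]. *)
exists (Num.max C 1); first by rewrite lt_max ltr01 orbT.
move=> D n d O LT n0 LTG eps M eps0 Mdp gamma K c b /andP[g0 g1] K1 c1 A.
have c0 : 0 < c%:R :> R by rewrite ltr0n (ltn_trans _ c1).
have K0 : 0 < K by rewrite (lt_trans ltr01).
set r := gamma `^ c%:R^-1.
have r0 : 0 < r by exact: powR_gt0.
have rc : r ^+ c = gamma.
  rewrite -powR_mulrn ?(ltW r0)// -powRrM mulVf ?gt_eqF//.
  by rewrite powRr1// ltW.
have r1 : r < 1.
  by rewrite -(expr_lt1 (n := c)) ?rc ?(ltW r0)// (ltn_trans _ c1).
(* The parameter of each run is admissible since [r < 1 < K]. *)
have eta01 : 0 < r / K < 1.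
  by rewrite divr_gt0//= ltr_pdivrMr// mul1r (lt_trans r1).
have [priv calls util] := LTG _ eta01 _ eps0 _ Mdp.
pose rho x := run (LT (r / K)) x (M x).
(* The call bound of a single run is a real number, hence finite. *)
have mass1 x : rho x setT = 1%E.
  by apply: expected_calls_lty_mass; apply: le_lt_trans (calls x) (ltry _).
split.
- move=> x y xy S mS; rewrite !output_best_of//.
  (* In this form the exponential is the [c]-th power of the factor [expR (3 * eps)] of one run. *)
  rewrite (_ : 3 * c%:R * eps = c%:R * (3 * eps)); last first.
    by rewrite mulrCA mulrA.
  rewrite expRM_natl; apply: giry_iid_le; first exact: expR_ge0.
    exact: priv xy.
  exact: measurable_preimage_best.
- move=> x; rewrite expected_calls_best_of; last exact: mass1.
  apply: (@le_trans _ _ ((C / (r / K))%:E *+ c)%E).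
    by rewrite -!mule_natl lee_wpmul2l//; exact: calls.
  rewrite -EFin_natmul lee_fin -[leLHS]mulr_natr.
  rewrite (_ : C / (r / K) * c%:R = C * (K * c%:R / r)); last first.
    by rewrite invf_div -!mulrA (mulrC r^-1).
  rewrite ler_pM2r ?le_max ?lexx//.
  by rewrite divr_gt0// mulr_gt0.
- move=> x q Mq.
  have mB : measurable [set v : O * R | score v < q].
    rewrite (_ : [set v | _] = setT `&` snd @^-1` `]-oo, q[%classic).
      exact: measurable_snd.
    by rewrite setTI; apply/seteqP; split=> v /=; rewrite in_itv.
  have BE : [set v : O * R | q <= score v] = ~` [set v | score v < q].
    by apply/seteqP; split=> v /=; rewrite leNgt => /negP.
  have out1 : output (A x) setT = 1%E.
    by rewrite output_setT best_of_setT//; exact: mass1.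
  (* Passing to complements leaves the event that all [c] scores are below [q], whose probability is
     a [c]-th power to be compared with [gamma = r ^+ c]. *)
  rewrite BE giry_setC// EFinB leeB// output_best_of//.
  rewrite best_preimage_score_lt (giry_iid_forall _ _ mB).
  rewrite -[X in (_ <= X%:E)%E]rc EFin_expe.
  (* The utility of one run bounds its failure probability by [K * (r / K) = r]. *)
  have : (output (rho x) [set v | (score v < q)%R] <= r%:E)%E.
    have := util x K q K1 Mq; rewrite BE giry_setC//; last exact: mass1.
    rewrite mulrCA divff ?gt_eqF// mulr1 EFinB.
    (* Finiteness allows the inequality between complements to be reversed in the reals. *)
    have : output (rho x) [set v | score v < q] \is a fin_num.
      by rewrite fin_num_measure.
    move=> /fineK <-.
    by rewrite -!EFinB !lee_fin lerD2l lerN2.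
  by apply: lee_expe.
Qed.
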